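(* Let $b\in\omega$ with $b\ge2$ and suppose the system function is constant, $\vartheta(n)=b$ for all $n\in\omega_+$. Then a non-zero real number $[a]\in\mathcal{S}_{\mathbb{R}}\setminus\{[0]\}$ is a $b$-adically terminating rational if and only if it has (i.e. contains) a secondary auxiliary function.
   Context: Conventions. $\omega=\{0,1,2,\dots\}$, $\omega_+=\omega\setminus\{0\}$, $[a,b]_\omega=\{n\in\omega:a\le n\le b\}$, $[a,\infty]_\omega=\{n\in\omega:n\ge a\}$; empty products equal $1$. A system function is a function $\vartheta:\omega_+\to[2,\infty]_\omega$; the following definitions are made for any fixed $\vartheta$. Contractions. For $f:\omega\to\omega$ and $n\in\omega_+$, the contraction $c_n$ is applicable to $f$ iff $f(n+1)\ge\vartheta(n)$, and then $c_n(f)(n)=f(n)+1$, $c_n(f)(n+1)=f(n+1)-\vartheta(n)$, $c_n(f)(k)=f(k)$ for other $k$. A sequence of contractions is a finite (possibly empty) composition of contractions; it is applicable to $f$ iff each contraction in turn is applicable to the result of the preceding ones. Sign. For $f:\omega\to\omega$, $\sigma(f)=0$ if $f(0)$ is odd and $\sigma(f)=1$ if $f(0)$ is even. Auxiliary functions. $h:\omega\to\omega$ is a primary auxiliary function ($h\in A_p$) if $h(k)<\vartheta(k-1)$ for all $k\ge2$ and for every $N\in\omega_+$ there is $M\ge N+1$ with $h(M)\ne\vartheta(M-1)-1$. It is a secondary auxiliary function ($h\in A_s$) if $h(k)<\vartheta(k-1)$ for all $k\ge2$ and there is $N\in\omega_+$ with $h(M)=\vartheta(M-1)-1$ for all $M\ge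 N+1$; the least such $N$ is $N^h_{\min}$. Base set. $W_1$ is the set of pairs $(h_p,h_s)\in A_p\times A_s$ such that, with $N=N^{h_s}_{\min}$, $h_p(k)=h_s(k)$ for $k<N$, $h_p(N)=h_s(N)+1$, and $h_p(k)=0$ for $k>N$. Two pairs in $W_1$ are equivalent if their first components agree on $\omega_+$ and have the same sign; $F$ is the collection of sets obtained by taking, for each equivalence class, the set of all functions that are components of its pairs. $W_2$ is the set of primary auxiliary functions occurring in no pair of $W_1$; two elements of $W_2$ are equivalent if they agree on $\omega_+$ and have the same sign; $G_2$ is the set of equivalence classes. The base set is $B=F\cup G_2$. Real numbers. For $\beta\in B$, $r_\beta$ is the set of $f:\omega\to\omega$ for which there is $h\in\beta$ such that for every $N\in\omega_+$ some sequence of contractions $\mathcal{C}$ applicable to $f$ satisfies $\mathcal{C}(f)(n)=h(n)$ for all $n\in[0,N]_\omega$. Let $\beta_1,\beta_2\in B$ be the elements containing respectively the zero function, and the function with value $1$ at $0$ and $0$ elsewhere. $\mathcal{S}_{\mathbb{R}}$ (the set of real numbers) consists of all $r_\beta$ with $\beta\in B\setminus\{\beta_1,\beta_2\}$ together with $[0]:=r_{\beta_1}\cup r_{\beta_2}$. Distinct real numbers are disjoint. A function lying in some real number is called finite, and $[f]$ denotes the real number containing $f$. $[1]:=[1_p]$, where $1_p(1)=1$ and $1_p(k)=0$ for $k\ne1$. For a real number $[a]$, $a_p$ and $a_s$ denote a primary and (if one exists) a secondary auxiliary function contained in $[a]$; their values on $\omega_+$ are uniquely determined. $\Psi(f,g)$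 denotes the least $n\in\omega_+$ with $f(n)\ne g(n)$. Multiplication. For $x,y\in\omega$ let $\Upsilon(x,y)=\max\{x,y\}-\min\{x,y\}$. For $n,k,K\in\omega_+$ let $$R(n,k,K)=\max\Big\{t\in\omega:\ t\prod_{j=1}^{n-1}\vartheta(j)\prod_{j=1}^{k-1}\vartheta(j)\le\prod_{j=1}^{K-1}\vartheta(j)\Big\}.$$ The rest function is $r(n,k,1)=R(n,k,1)$ and $r(n,k,M)=\Upsilon\big(R(n,k,M),\ \vartheta(M-1)R(n,k,M-1)\big)$ for $M\ge2$. For finite $f,g$ the sub-product $f*g:\omega\to\omega$ is $(f*g)(0)=f(0)+g(0)$ and $(f*g)(M)=\sum_{n=1}^M\sum_{k=1}^M f(n)g(k)\,r(n,k,M)$ for $M\in\omega_+$. Multiplication of real numbers: $[f]*[g]:=[f*g]$ for any $f\in[f]$, $g\in[g]$ (independent of the choice of representatives). For $[c]\ne[0]$, $[c]^{-1}$ is the unique real number with $[c]*[c]^{-1}=[1]$. Integers and rationals. A real number $[a]$ is an integer if $[a]=[0]$, or if $[a]$ contains a secondary auxiliary function and $\Psi(a_p,a_s)=1$. A real number $[a]$ is rational if $[a]=[d]*[c]^{-1}$ for some integers $[d],[c]$ with $[c]\ne[0]$. For a natural number $b\ge2$ let $[b]$ be the integer containing the function $b_p$ with $b_p(1)=b$ and $b_p(n)=0$ for $n\ne1$, and let $[b^N]=[b]*\dots*[b]$ ($N$ factors, $[b^0]=[1]$). A rational number $[a]$ is $b$-adically terminating if there exist an integer $[c]$ and $N\in\omega$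 with $[a]=[c]*[b^N]^{-1}$. *)

(* Defs.v *)
From mathcomp Require Import all_boot.
From mathcomp Require Import boolp classical_sets.

Local Open Scope classical_set_scope.

(* Functions defined on the positive integers are represented by functions
   [nat -> nat] whose value at 0 is never used.  [get P] denotes "the" element
   of [P]; its value is unspecified when [P] is empty. *)

Definition system_function (theta : nat -> nat) : Prop :=
  forall n, 0 < n -> 2 <= theta n.

Definition least (P : set nat) : nat :=
  get [set n | P n /\ forall m, P m -> n <= m].

Definition greatest (P : set nat) : nat :=
  get [set n | P n /\ forall m, P m -> m <= n].

Definition applicable (theta : nat -> nat) (n : nat) (f : nat -> nat) : Prop :=
  0 < n /\ theta n <= f n.+1.

Definition contraction (theta : nat -> nat) (n : nat) (f : nat -> nat) :
    nat -> nat :=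
  fun k => if k == n then f n + 1
           else if k == n.+1 then f n.+1 - theta n
           else f k.

(* A sequence of contractions is given by the list of its indices, the head of
   the list being the contraction that is applied first. *)
Fixpoint seq_applicable (theta : nat -> nat) (s : seq nat) (f : nat -> nat) :
    Prop :=
  if s is n :: s' then
    applicable theta n f /\ seq_applicable theta s' (contraction theta n f)
  else True.

Fixpoint seq_contraction (theta : nat -> nat) (s : seq nat) (f : nat -> nat) :
    nat -> nat :=
  if s is n :: s' then seq_contraction theta s' (contraction theta n f) else f.

Definition sigma (f : nat -> nat) : nat := if odd (f 0) then 0 else 1.

Definition primary_aux (theta : nat -> nat) : set (nat -> nat) :=
  [set h | (forall k, 2 <= k -> h k < theta k.-1) /\
           (forall N, 0 < N ->
              exists M, N.+1 <= M /\ h M <> theta M.-1 - 1)].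

Definition maximal_after (theta h : nat -> nat) : set nat :=
  [set N | 0 < N /\ forall M, N.+1 <= M -> h M = theta M.-1 - 1].

Definition secondary_aux (theta : nat -> nat) : set (nat -> nat) :=
  [set h | (forall k, 2 <= k -> h k < theta k.-1) /\
           (exists N, maximal_after theta h N)].

Definition Nmin (theta h : nat -> nat) : nat := least (maximal_after theta h).

Definition W1 (theta : nat -> nat) : set ((nat -> nat) * (nat -> nat)) :=
  [set p | [/\ primary_aux theta p.1,
               secondary_aux theta p.2,
               forall k, k < Nmin theta p.2 -> p.1 k = p.2 k,
               p.1 (Nmin theta p.2) = p.2 (Nmin theta p.2) + 1 &
               forall k, Nmin theta p.2 < k -> p.1 k = 0]].

Definition aux_equiv (f g : nat -> nat) : Prop :=
  (forall k, 0 < k -> f k = g k) /\ sigma f = sigma g.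

Definition base_F (theta : nat -> nat) : set (set (nat -> nat)) :=
  [set beta | exists2 p, W1 theta p &
     beta = [set f | exists q, [/\ W1 theta q, aux_equiv p.1 q.1 &
                                   f = q.1 \/ f = q.2]]].

Definition W2 (theta : nat -> nat) : set (nat -> nat) :=
  [set h | primary_aux theta h /\
           ~ (exists2 p, W1 theta p & h = p.1 \/ h = p.2)].

Definition base_G2 (theta : nat -> nat) : set (set (nat -> nat)) :=
  [set beta | exists2 h, W2 theta h &
     beta = [set g | W2 theta g /\ aux_equiv h g]].

Definition base_set (theta : nat -> nat) : set (set (nat -> nat)) :=
  base_F theta `|` base_G2 theta.

Definition r_ (theta : nat -> nat) (beta : set (nat -> nat)) :
    set (nat -> nat) :=
  [set f | exists2 h, beta h & forall N, 0 < N ->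
     exists C, seq_applicable theta C f /\
               forall n, n <= N -> seq_contraction theta C f n = h n].

Definition base_of (theta h : nat -> nat) : set (nat -> nat) :=
  get [set beta | base_set theta beta /\ beta h].

Definition beta1 (theta : nat -> nat) : set (nat -> nat) :=
  base_of theta (fun _ => 0).

Definition beta2 (theta : nat -> nat) : set (nat -> nat) :=
  base_of theta (fun k => if k == 0 then 1 else 0).

Definition real0 (theta : nat -> nat) : set (nat -> nat) :=
  r_ theta (beta1 theta) `|` r_ theta (beta2 theta).

Definition reals (theta : nat -> nat) : set (set (nat -> nat)) :=
  [set a | a = real0 theta \/
     exists beta, [/\ base_set theta beta, beta <> beta1 theta,
                      beta <> beta2 theta & a = r_ theta beta]].

Definition real_of (theta f : nat -> nat) : set (nat -> nat) :=
  get [set a | reals theta a /\ a f].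

(* The function b_p; for b = 1 it is 1_p. *)
Definition nat_primary (b : nat) : nat -> nat :=
  fun k => if k == 1 then b else 0.

Definition real_nat (theta : nat -> nat) (b : nat) : set (nat -> nat) :=
  real_of theta (nat_primary b).

Definition real1 (theta : nat -> nat) : set (nat -> nat) := real_nat theta 1.

Definition Psi (f g : nat -> nat) : nat :=
  least [set n | 0 < n /\ f n <> g n].

Definition Upsilon (x y : nat) : nat := maxn x y - minn x y.

Definition R (theta : nat -> nat) (n k K : nat) : nat :=
  greatest [set t |
    t * (\prod_(1 <= j < n) theta j) * (\prod_(1 <= j < k) theta j)
      <= \prod_(1 <= j < K) theta j].

Definition rest (theta : nat -> nat) (n k M : nat) : nat :=
  if M == 1 then R theta n k 1
  else Upsilon (R theta n k M) (theta M.-1 * R theta n k M.-1).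

Definition subproduct (theta f g : nat -> nat) : nat -> nat :=
  fun M => if M == 0 then f 0 + g 0
           else \sum_(1 <= n < M.+1) \sum_(1 <= k < M.+1)
                  f n * g k * rest theta n k M.

(* [get a] and [get c] are arbitrarily chosen representatives; the product of
   two real numbers does not depend on this choice. *)
Definition real_mul (theta : nat -> nat) (a c : set (nat -> nat)) :
    set (nat -> nat) :=
  real_of theta (subproduct theta (get a) (get c)).

Definition real_inv (theta : nat -> nat) (c : set (nat -> nat)) :
    set (nat -> nat) :=
  get [set d | reals theta d /\ real_mul theta c d = real1 theta].

(* For N > 0 the product has exactly N factors. *)
Definition real_exp (theta : nat -> nat) (a : set (nat -> nat)) (N : nat) :
    set (nat -> nat) :=
  iterop N (real_mul theta) a (real1 theta).

Definition is_integer (theta : nat -> nat) (a : set (nat -> nat)) : Prop :=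
  reals theta a /\
  (a = real0 theta \/
   exists ap as_, [/\ primary_aux theta ap, a ap,
                      secondary_aux theta as_, a as_ & Psi ap as_ = 1]).

Definition is_rational (theta : nat -> nat) (a : set (nat -> nat)) : Prop :=
  reals theta a /\
  exists d c, [/\ is_integer theta d, is_integer theta c, c <> real0 theta &
                  a = real_mul theta d (real_inv theta c)].

Definition b_adically_terminating (theta : nat -> nat) (b : nat)
    (a : set (nat -> nat)) : Prop :=
  is_rational theta a /\
  exists c N, is_integer theta c /\
    a = real_mul theta c (real_inv theta (real_exp theta (real_nat theta b) N)).

(* Main.v *)
(* With the constant base [b], a function [f] of finite type stands for
   [+/- sum_(i >= 0) f(i+1) / b^i], the sign being the parity of [f 0].
   Contractions preserve this value; conversely, replacing the first digits by
   the integer parts of the partial sums shows that every [f] with convergent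
   series contracts to an auxiliary function.  Hence each real number is the set
   of all functions of a given signed value, and its multiplication is the
   Cauchy product of series.  An auxiliary function that is finally maximal has
   value [+/- m / b^n] with [m > 0]; conversely, [m / b^n] is also the value of
   the digits of [m - 1] at scale [b^n] followed by maximal digits only. *)

From Stdlib Require Import Reals Lra.
From Coquelicot Require Import Coquelicot.
Require Import Defs.
From mathcomp Require Import all_boot zify.
From mathcomp Require Import boolp classical_sets.

Delimit Scope R_scope with R.
Local Close Scope R_scope.
Local Open Scope classical_set_scope.
Local Open Scope nat_scope.

Section ConstantSystem.

Variables (b : nat) (theta : nat -> nat).
Hypothesis b_ge2 : 2 <= b.
Hypothesis theta_const : forall n, 0 < n -> theta n = b.

Let b_gt0 : 0 < b. Proof. exact: ltnW. Qed.

(** * Scaled partial sums and the carrying of digits *)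

(* [lead f M = sum_(i <= M) f(i+1) b^(M-i)]: the partial sum up to [b^-M],
   scaled to a natural number. *)
Fixpoint lead (f : nat -> nat) (M : nat) : nat :=
  if M is M'.+1 then b * lead f M' + f M.+1 else f 1.

Lemma eq_lead f g M :
  (forall i, i <= M -> f i.+1 = g i.+1) -> lead f M = lead g M.
Proof.
elim: M => [|M IH] efg /=; first exact: efg.
by rewrite IH ?efg // => i /leqW; apply: efg.
Qed.

Lemma lead_inj f g N :
  (forall i, i <= N -> lead f i = lead g i) ->
  forall k, 0 < k <= N.+1 -> f k = g k.
Proof.
move=> efg [|[|k]] //= kN; first exact: (efg 0).
rewrite ltnS in kN.
by have := efg _ kN; rewrite /= (efg k) ?(ltnW kN) // => /addnI.
Qed.

(** Contraction [n] trades [b] units of weight [b^-n] for one unit of weight [b^-(n-1)]. Only the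
    partial sum that ends between the two positions notices the trade. *)
Lemma lead_contraction f n M : 0 < n -> theta n <= f n.+1 ->
  lead (contraction theta n f) M = lead f M + (M.+1 == n).
Proof.
case: n => // n _; rewrite theta_const // => le_bf.
have low k : k < n ->
    lead (contraction theta n.+1 f) k = lead f k.
  move=> kn; apply: eq_lead => i ik; rewrite /contraction.
  by rewrite !ifF //; lia.
have at_n : lead (contraction theta n.+1 f) n = (lead f n).+1.
  case: (n) low => [|m] low /=; rewrite ?low // /contraction eqxx addn1 //.
  by rewrite addnS.
have at_n1 : lead (contraction theta n.+1 f) n.+1 = lead f n.+1.
  rewrite /= at_n /contraction theta_const // eqxx ifF; last lia.
  by rewrite mulnS; lia.
rewrite eqSS; have [/low -> |nM |->] := ltngtP M n; last by rewrite at_n addn1.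
  by rewrite addn0.
rewrite addn0; elim: M nM => // M IH; rewrite ltnS leq_eqVlt.
case/predU1P => [<- //|nM] /=; rewrite IH //; congr (_ + _).
by rewrite /contraction !ifF //; lia.
Qed.

Lemma contraction0 f n : 0 < n -> contraction theta n f 0 = f 0.
Proof. by case: n. Qed.

Lemma seq_contraction0 C f :
  seq_applicable theta C f -> seq_contraction theta C f 0 = f 0.
Proof.
by elim: C f => //= n C IH f [[n_gt0 _] /IH ->]; rewrite contraction0.
Qed.

Lemma lead_seq_contraction_ge C f M :
  seq_applicable theta C f -> lead f M <= lead (seq_contraction theta C f) M.
Proof.
elim: C f => //= n C IH f [[n_gt0 le_f] /IH]; apply: leq_trans.
by rewrite lead_contraction // leq_addr.
Qed.

(** Each contraction changes a single partial sum, so a finite sequence changes only finitely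
    many. *)
Lemma lead_seq_contraction C f : seq_applicable theta C f ->
  exists M0, forall M, M0 <= M -> lead (seq_contraction theta C f) M = lead f M.
Proof.
elim: C f => [|n C IH] f /=; first by exists 0.
move=> [[n_gt0 le_f] /IH [M0 eM]]; exists (maxn M0 n) => M.
rewrite geq_max => /andP[/eM -> nM]; rewrite lead_contraction //.
by rewrite eqn_leq ltnNge nM addn0.
Qed.

Lemma seq_contraction_cat C C' f : seq_contraction theta (C ++ C') f =
  seq_contraction theta C' (seq_contraction theta C f).
Proof. by elim: C f => /=. Qed.

Lemma seq_applicable_cat C C' f :
  seq_applicable theta C f ->
  seq_applicable theta C' (seq_contraction theta C f) ->
  seq_applicable theta (C ++ C') f.
Proof. by elim: C f => //= n C IH f [? ?] ?; split=> //; apply: IH. Qed.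

Lemma seq_contraction_nseq q n f : 0 < n -> q * b <= f n.+1 ->
  seq_applicable theta (nseq q n) f /\
  seq_contraction theta (nseq q n) f =1
    fun k => if k == n then f n + q
             else if k == n.+1 then f n.+1 - q * b else f k.
Proof.
move=> n_gt0; elim: q f => [|q IH] f qf /=.
  split=> // k; rewrite addn0 subn0.
  by case: eqP => [->|_] //; case: eqP => [->|].
have [|? e] := IH (contraction theta n f).
  by rewrite /contraction theta_const // eqxx eqn_leq ltnn /=; lia.
split; first by split=> //; split=> //; rewrite theta_const //; lia.
move=> k; rewrite e /contraction theta_const // !eqxx.
have -> : (n.+1 == n) = false by rewrite eqn_leq ltnn.
by case: (k == n); case: (k == n.+1) => //; rewrite ?mulSn; lia.
Qed.

(** Carry from right to left: the last digit is reduced modulo [b], its quotient is added to the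
    digit before it, and induction treats the rest. Position 1 absorbs the final carry and stays
    unbounded. *)
Lemma normalize M f : exists C,
  [/\ seq_applicable theta C f,
      forall i, i <= M ->
        lead (seq_contraction theta C f) i = lead f M %/ b ^ (M - i),
      forall k, M.+1 < k -> seq_contraction theta C f k = f k &
      forall k, 2 <= k <= M.+1 -> seq_contraction theta C f k < b].
Proof.
elim: M f => [|M IH] f.
  exists [::]; split=> //= [i|k].
    by rewrite leqn0 => /eqP ->; rewrite divn1.
  by case/andP=> /leq_trans /[apply].
have [|app1 e1] := @seq_contraction_nseq (f M.+2 %/ b) M.+1 f isT.
  exact: leq_divM.
set f1 := seq_contraction _ _ _ in app1 e1.
have f1M : f1 M.+2 = f M.+2 %% b.
  rewrite e1 eqxx (negbTE (_ : M.+2 != M.+1)); last by rewrite eqn_leq ltnn.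
  by rewrite {1}(divn_eq (f M.+2) b) addKn.
(* The carry turns the partial sum at [M] into a floor quotient of the one at [M.+1]; nested floor
   quotients then compose. *)
have lf1 : lead f1 M = lead f M.+1 %/ b.
  rewrite /= [b * _]mulnC divnMDl //.
  case: (M) e1 => [|m] e1 /=; rewrite e1 eqxx // addnA; congr (_ * _ + _ + _).
  apply: eq_lead => i im; rewrite e1.
  by rewrite !ifF //; lia.
have [C [app el eh ed]] := IH f1.
exists (nseq (f M.+2 %/ b) M.+1 ++ C); rewrite seq_contraction_cat -/f1.
split.
- exact: seq_applicable_cat.
- move=> i; rewrite leq_eqVlt => /predU1P[->|].
    rewrite subnn divn1 [RHS](divn_eq _ b) -lf1 /= el // subnn divn1 eh //.
    by rewrite f1M [b * lead f M]mulnC modnMDl [lead f1 M * b]mulnC.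
  by rewrite ltnS => iM; rewrite el // lf1 -divnMA -expnS subSn.
- move=> k Mk; by rewrite eh ?(ltnW Mk) // e1 !ifF //; lia.
- move=> k /andP[k2]; rewrite leq_eqVlt => /predU1P[->|kM].
    by rewrite eh // f1M ltn_mod.
  by apply: ed; rewrite k2.
Qed.

Lemma lead_shift_ge f M k : lead f M * b ^ k <= lead f (M + k).
Proof.
elim: k => [|k IH]; first by rewrite muln1 addn0.
rewrite addnS expnSr mulnA /= mulnC.
by apply: leq_trans (leq_addr _ _); rewrite leq_mul2l IH orbT.
Qed.

(** * Contraction to reduced functions *)

(** The approximation condition of [r_], isolated from the choice of [h] in [beta]. *)
Definition reaches (f h : nat -> nat) : Prop :=
  forall N, 0 < N -> exists C, seq_applicable theta C f /\
    forall n, n <= N -> seq_contraction theta C f n = h n.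

Definition reduced (h : nat -> nat) : Prop := forall k, 2 <= k -> h k < b.

Lemma nondecreasing_bounded_eventually_const (u : nat -> nat) K :
  {homo u : m n / m <= n} -> (forall n, u n <= K) ->
  exists a n0, forall n, n0 <= n -> u n = a.
Proof.
move=> u_mono; elim: K => [|K IH] uK.
  by exists 0, 0 => n _; apply/eqP; rewrite -leqn0.
have [[n0 un0]|noK] := pselect (exists n, u n = K.+1).
  by exists K.+1, n0 => n /u_mono; have := uK n; lia.
apply: IH => n; have := uK n; rewrite leq_eqVlt => /predU1P[un|//].
by case: noK; exists n.
Qed.

(** For fixed [i] the floors of [lead f M / b^(M-i)] increase with [M] and are bounded, hence become
    constant. The limits are the partial sums of [h], and normalizing [f] at a large [M] reproduces
    [h] up to [N]. *)
Lemma bounded_reaches f K : (forall M, lead f M <= K * b ^ M) ->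
  exists h, [/\ h 0 = f 0, reduced h & reaches f h].
Proof.
move=> fK.
(* [am] pairs the eventual value of the floors with a threshold, counted from [i]. *)
have /choice[A eA] i : exists am, forall M, am.2 + i <= M ->
    lead f M %/ b ^ (M - i) = am.1.
  pose u k := lead f (i + k) %/ b ^ k.
  have [||a [n0 ua]] := @nondecreasing_bounded_eventually_const u (K * b ^ i).
  - move=> m n mn; rewrite /u -(subnKC mn) addnA expnD [b ^ m * _]mulnC divnMA.
    by apply: leq_div2r; rewrite leq_divRL ?expn_gt0 ?b_gt0 // lead_shift_ge.
  - move=> k; rewrite -[leqRHS](@mulnK _ (b ^ k)) ?expn_gt0 ?b_gt0 //.
    by rewrite leq_div2r // -mulnA -expnD.
  exists (a, n0) => M /= le_M; rewrite -(ua (M - i)); last lia.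
  by rewrite /u subnKC //; lia.
(* The maximum of the thresholds serves all [i <= N] at once. *)
have uniform N : exists2 M, N <= M &
    forall i, i <= N -> lead f M %/ b ^ (M - i) = (A i).1.
  exists (\max_(i < N.+1) ((A i).2 + i)) => [|i iN].
    apply: leq_trans (leq_bigmax ord_max).
    exact: leq_addl.
  apply: eA; rewrite -ltnS in iN.
  exact: (@leq_bigmax _ (fun i : 'I_N.+1 => (A i).2 + i) (Ordinal iN)).
pose h k := if k is k'.+1 then if k' is _.+1 then (A k').1 %% b else (A 0).1
            else f 0.
(* The limit at [i] is the floor of the limit at [i.+1] divided by [b], so the remainders modulo [b]
   are the digits. *)
have lead_h i : lead h i = (A i).1.
  elim: i => //= i ->; have [M iM eM] := uniform i.+1.
  rewrite [RHS](divn_eq _ b) mulnC; congr (_ * _ + _).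
  by rewrite -!eM // -divnMA -expnSr -subSn.
exists h; split=> [//|[|[|k]] // _|N N_gt0]; first by rewrite ltn_mod.
have [M NM eM] := uniform N; have [C [app eC _ _]] := normalize M f.
exists C; split=> // -[_|n nN]; first by rewrite seq_contraction0.
apply: (@lead_inj _ _ N) => [i iN|]; last by rewrite /= leqW.
by rewrite eC ?(leq_trans iN) // eM // lead_h.
Qed.

(** * The value of a function *)

Definition term (f : nat -> nat) (i : nat) : Rdefinitions.R :=
  (INR (f i.+1) / INR b ^ i)%R.

Definition has_sum (f : nat -> nat) (x : Rdefinitions.R) : Prop :=
  is_series (term f) x.

Let Rb_gt1 : (1 < INR b)%R.
Proof. by apply: (lt_INR 1); apply/ltP. Qed.

Let Rb_pow_gt0 n : (0 < INR b ^ n)%R.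
Proof. by apply: pow_lt; lra. Qed.

Lemma INR_expn n : INR (b ^ n) = (INR b ^ n)%R.
Proof. by elim: n => // n IH; rewrite expnS mult_INR IH. Qed.

Lemma term_ge0 f i : (0 <= term f i)%R.
Proof. by apply: Rdiv_le_0_compat; [exact: pos_INR | exact: Rb_pow_gt0]. Qed.

Lemma sum_n_term f M :
  sum_n (term f) M = (INR (lead f M) / INR b ^ M)%R.
Proof.
elim: M => [|M IH]; first by rewrite sum_O.
rewrite sum_Sn IH /plus /= /term plus_INR mult_INR /=.
by field; split; [exact: Rgt_not_eq (Rb_pow_gt0 M) | lra].
Qed.

Lemma has_sum_unique f x y : has_sum f x -> has_sum f y -> x = y.
Proof. by move=> /is_series_unique <- /is_series_unique. Qed.

Lemma has_sum_lead f x M : has_sum f x -> (INR (lead f M) <= x * INR b ^ M)%R.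
Proof.
move=> fx; have := @is_lim_seq_incr_compare _ _ fx _ M.
rewrite sum_n_term => /(_ _); have pM := Rb_pow_gt0 M.
suff le_n n : (sum_n (term f) n <= sum_n (term f) n.+1)%R.
  move=> /(_ le_n)/(Rmult_le_compat_r _ _ _ (Rlt_le _ _ pM)).
  by rewrite /Rdiv Rmult_assoc Rinv_l ?Rmult_1_r //; lra.
by rewrite sum_Sn /plus /=; have := term_ge0 f n.+1; lra.
Qed.

Lemma has_sum_le f x y n : has_sum f x ->
  (forall M, n <= M -> (INR (lead f M) <= y * INR b ^ M)%R) -> (x <= y)%R.
Proof.
move=> fx le_y.
apply: (@is_lim_seq_le_loc (sum_n (term f)) (fun=> y) x y) => //; last first.
  exact: is_lim_seq_const.
exists n => M /leP/le_y yM; rewrite sum_n_term.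
apply: (Rmult_le_reg_r (INR b ^ M)%R) => //.
rewrite /Rdiv Rmult_assoc Rinv_l ?Rmult_1_r //.
exact: Rgt_not_eq (Rb_pow_gt0 M).
Qed.

Lemma bounded_has_sum f x :
  (forall M, INR (lead f M) <= x * INR b ^ M)%R -> exists y, has_sum f y.
Proof.
move=> le_x.
have [||y fy] := @ex_finite_lim_seq_incr (sum_n (term f)) x; last by exists y.
  by move=> n; rewrite sum_Sn /plus /=; have := term_ge0 f n.+1; lra.
move=> M; rewrite sum_n_term.
apply: (Rmult_le_reg_r (INR b ^ M)%R) => //.
rewrite /Rdiv Rmult_assoc Rinv_l ?Rmult_1_r //.
exact: Rgt_not_eq (Rb_pow_gt0 M).
Qed.

Lemma has_sum_bounded f x : has_sum f x ->
  exists K, forall M, lead f M <= K * b ^ M.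
Proof.
move=> fx; have [K xK] := INR_unbounded x; exists K => M.
apply/leP/INR_le; rewrite mult_INR INR_expn.
apply: Rle_trans (has_sum_lead f x M fx) _.
by apply: Rmult_le_compat_r; [exact/Rlt_le | lra].
Qed.

(* Covers both finitely supported functions ([e = 0]) and functions ending in
   maximal digits ([e = 1]). *)
Lemma has_sum_eventually f n a e :
  (forall M, n <= M -> lead f M + e = a * b ^ (M - n)) ->
  has_sum f (INR a / INR b ^ n).
Proof.
move=> fa.
(* The partial sum up to [b^-M] equals [a / b^n - e / b^M]. *)
have lim : is_lim_seq (fun M => INR a / INR b ^ n - INR e * (/ INR b) ^ M)%R
    (INR a / INR b ^ n - INR e * 0)%R.
  apply: is_lim_seq_minus'; first exact: is_lim_seq_const.
  apply: (is_lim_seq_scal_l _ (INR e) 0%R); apply: is_lim_seq_geom.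
  rewrite Rabs_pos_eq; last by apply/Rlt_le/Rinv_0_lt_compat; lra.
  by rewrite -Rinv_1; apply: Rinv_lt_contravar; lra.
rewrite Rmult_0_r Rminus_0_r in lim.
apply: is_lim_seq_ext_loc lim; exists n => M /leP nM.
have := f_equal INR (fa M nM).
rewrite sum_n_term plus_INR mult_INR INR_expn pow_inv => eM.
have -> : INR (lead f M) = (INR a * INR b ^ (M - n) - INR e)%R by lra.
have -> : (INR b ^ M = INR b ^ (M - n) * INR b ^ n)%R.
  by rewrite -pow_add; congr (_ ^ _)%R; lia.
field; split; exact: Rgt_not_eq (Rb_pow_gt0 _).
Qed.

Lemma eq_has_sum f g x :
  (forall k, 0 < k -> f k = g k) -> has_sum f x -> has_sum g x.
Proof. by move=> e; apply: is_series_ext => i; rewrite /term e. Qed.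

(** A sequence of contractions that produces [h] up to [N.+1] leaves the partial sums of [f] far out
    unchanged, and these are bounded by [x]. *)
Lemma reaches_lead_le f h x N : reaches f h -> has_sum f x ->
  (INR (lead h N) <= x * INR b ^ N)%R.
Proof.
move=> fh fx; have [C [app eC]] := fh N.+1 isT.
have [M0 eM] := lead_seq_contraction C f app.
have := has_sum_lead f x (N + M0) fx; rewrite -eM ?leq_addl // => leM.
have := lead_shift_ge (seq_contraction theta C f) N M0 => /leP/le_INR.
rewrite mult_INR INR_expn (@eq_lead _ h N); last by move=> i iM; rewrite eC.
rewrite pow_add in leM => /Rle_trans/(_ leM); rewrite -Rmult_assoc.
exact: Rmult_le_reg_r.
Qed.

(** Contractions only raise partial sums, so [x] bounds those of [f]; [reaches_lead_le] gives the
    opposite inequality. *)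
Lemma reaches_has_sum f h x : reaches f h -> has_sum h x -> has_sum f x.
Proof.
move=> fh hx.
have le_lead M : (INR (lead f M) <= x * INR b ^ M)%R.
  apply: Rle_trans (has_sum_lead h x M hx); apply/le_INR/leP.
  have [C [app eC]] := fh M.+1 isT.
  rewrite (@eq_lead h (seq_contraction theta C f)).
    exact: lead_seq_contraction_ge.
  by move=> i iM; rewrite eC.
have [y fy] := bounded_has_sum f x le_lead.
suff -> : x = y by [].
apply: Rle_antisym; last exact: (@has_sum_le f y x 0).
by apply: (@has_sum_le h x y 0) => // N _; apply: reaches_lead_le fh fy.
Qed.

Lemma has_sum_reaches f h x : reaches f h -> has_sum f x -> has_sum h x.
Proof.
move=> fh fx; have [y hy] : exists y, has_sum h y.
  by apply: (@bounded_has_sum h x) => N; apply: reaches_lead_le fh fx.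
by rewrite (has_sum_unique f x y fx (reaches_has_sum f h y fh hy)).
Qed.

(** * Expansions of real numbers *)

(** Finitely many digits below [b] amount to less than one unit of the preceding place. *)
Lemma reduced_lead h N k : reduced h -> lead h (N + k) < (lead h N).+1 * b ^ k.
Proof.
move=> hr; elim: k => [|k IH]; first by rewrite addn0 muln1.
rewrite addnS expnSr mulnA /=; have := hr (N + k).+2 isT.
move: IH; set u := lead h _; set v := _ * _ => uv hb.
have : b * u.+1 <= v * b by rewrite mulnC leq_mul2r uv orbT.
by rewrite mulnS; lia.
Qed.

Lemma reduced_has_sum h : reduced h -> exists x, has_sum h x.
Proof.
move=> hr; apply: (@bounded_has_sum h (INR (h 1).+1)) => M.
rewrite -INR_expn -mult_INR; apply/le_INR/leP/ltnW.
exact: (reduced_lead h 0 M).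
Qed.

(** In the limit the bound on the tail is no longer strict: maximal digits throughout attain it. *)
Lemma reduced_has_sum_le h x N : reduced h -> has_sum h x ->
  (x * INR b ^ N <= INR (lead h N) + 1)%R.
Proof.
move=> hr hx; have pN := Rb_pow_gt0 N.
have -> : (INR (lead h N) + 1 =
           (INR (lead h N) + 1) / INR b ^ N * INR b ^ N)%R by field; lra.
apply: Rmult_le_compat_r; first lra.
apply: (@has_sum_le h x _ N) => // M NM.
rewrite -(subnKC NM) pow_add -S_INR.
have -> (u v w : Rdefinitions.R) : (0 < v -> u / v * (v * w) = u * w)%R.
  by move=> v_gt0; field; lra.
  rewrite -INR_expn -mult_INR; apply/le_INR/leP/ltnW.
  exact: reduced_lead.
by [].
Qed.

Lemma primary_reduced h : primary_aux theta h -> reduced h.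
Proof. by case=> hr _ k k2; rewrite -(theta_const k.-1) ?hr //; lia. Qed.

Lemma secondary_reduced h : secondary_aux theta h -> reduced h.
Proof. by case=> hr _ k k2; rewrite -(theta_const k.-1) ?hr //; lia. Qed.

Lemma reduced_auxVaux h :
  reduced h -> primary_aux theta h \/ secondary_aux theta h.
Proof.
move=> hr; have hr' k : 2 <= k -> h k < theta k.-1.
  by move=> k2; rewrite theta_const ?hr //; lia.
have [[N Nmax]|noN] := pselect (exists N, maximal_after theta h N).
  by right; split=> //; exists N.
left; split=> // N N_gt0; apply: contrapT => noM; apply: noN; exists N.
split=> // M NM; apply: contrapT => hM; apply: noM; by exists M.
Qed.

Lemma primary_not_secondary h :
  primary_aux theta h -> secondary_aux theta h -> False.
Proof.
by case=> _ hp [_ [N [N_gt0 Nmax]]]; have [M [/Nmax]] := hp N N_gt0.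
Qed.

Lemma primary_has_sum_lt h x N : primary_aux theta h -> has_sum h x ->
  (x * INR b ^ N < INR (lead h N) + 1)%R.
Proof.
move=> hp hx; have hr := primary_reduced h hp.
have [M [NM hM]] := hp.2 N.+1 isT.
have [k eM] : exists k, M = (N + k).+2 by exists (M - N.+2); lia.
rewrite {M NM}eM /= theta_const // in hM.
(* A non-maximal digit leaves a gap of two units at its place; the remaining tail fills at most one,
   which makes the bound strict. *)
have lt_lead : (lead h (N + k).+1).+2 <= (lead h N).+1 * b ^ k.+1.
  have := reduced_lead h N k hr; have := hr (N + k).+2 isT.
  rewrite expnSr mulnA /=; set u := lead h _; set v := _ * _ => hb uv.
  have : b * u.+1 <= v * b by rewrite mulnC leq_mul2r uv orbT.
  by rewrite mulnS; lia.
have := reduced_has_sum_le h x (N + k).+1 hr hx.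
have := le_INR _ _ (leP lt_lead); rewrite mult_INR INR_expn !S_INR => le1 le2.
apply: (Rmult_lt_reg_r (INR b ^ k.+1)%R) => //.
rewrite Rmult_assoc -pow_add.
by have -> : Nat.add N k.+1 = (N + k).+1; [lia | lra].
Qed.

(** The strict bound makes [lead g N] the floor of [x * b^N], so [x] determines all partial sums. *)
Lemma primary_unique g h x :
  primary_aux theta g -> primary_aux theta h -> has_sum g x -> has_sum h x ->
  forall k, 0 < k -> g k = h k.
Proof.
move=> gp hp gx hx k k_gt0.
apply: (@lead_inj g h k.-1); last lia.
move=> N _; have := has_sum_lead g x N gx; have := has_sum_lead h x N hx.
have := primary_has_sum_lt g x N gp gx; have := primary_has_sum_lt h x N hp hx.
rewrite -!S_INR => h1 g1 h2 g2.
have /INR_lt/ltP := Rle_lt_trans _ _ _ h2 g1.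
have /INR_lt/ltP := Rle_lt_trans _ _ _ g2 h1.
by lia.
Qed.

(** The maximal digits after position [n.+1] add up to one unit [b^-n], whence the successor. *)
Lemma maximal_has_sum h n : maximal_after theta h n.+1 ->
  has_sum h (INR (lead h n).+1 / INR b ^ n).
Proof.
move=> [_ hmax]; apply: (@has_sum_eventually _ _ _ 1) => M nM.
rewrite -(subnKC nM) addKn; elim: (M - n) => [|k IH].
  by rewrite addn0 muln1 addn1.
rewrite (addnS n k) expnSr mulnA -IH /= hmax ?theta_const //; last lia.
by rewrite mulnDl mulnC; lia.
Qed.

Lemma leastP (P : set nat) : (exists n, P n) ->
  P (least P) /\ forall m, P m -> least P <= m.
Proof.
move=> exP; apply: (getPex (P := [set n | P n /\ forall m, P m -> n <= m])).
have exP' : exists n, `[< P n >] by case: exP => n Pn; exists n; apply/asboolP.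
case: (ex_minnP exP') => n /asboolP Pn n_min; exists n; split=> // m Pm.
by apply: n_min; apply/asboolP.
Qed.

Lemma NminP h : secondary_aux theta h ->
  maximal_after theta h (Nmin theta h) /\
  forall N, maximal_after theta h N -> Nmin theta h <= N.
Proof. by case=> _ /leastP. Qed.

Lemma eq_maximal_after g h : (forall k, 2 <= k -> g k = h k) ->
  maximal_after theta g = maximal_after theta h.
Proof.
move=> e; apply/seteqP; split=> N [N_gt0 hN]; split=> // M NM;
  by rewrite -hN // e //; lia.
Qed.

(** The terminating expansion of the same sum: the maximal tail is replaced by a carry into position
    [Nmin theta h]. *)
Definition partner (h : nat -> nat) : nat -> nat :=
  fun k => if k < Nmin theta h then h k
           else if k == Nmin theta h then h k + 1 else 0.

Lemma partner_W1 h : secondary_aux theta h -> W1 theta (partner h, h).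
Proof.
move=> hs; have hr := secondary_reduced h hs.
have [[N_gt0 Nmax] Nleast] := NminP h hs.
split=> //=; rewrite /partner.
- split=> [k k2|N _] /=.
    rewrite theta_const; last lia.
    case: (ltngtP k (Nmin theta h)) => [_|_|kN]; [exact: hr| by rewrite b_gt0 |].
    (* If the digit at [k = Nmin theta h] were maximal, [k.-1] would also belong to
       [maximal_after theta h], against minimality. *)
    rewrite addn1 ltn_neqAle hr // andbT; apply/eqP => hk.
    suff : Nmin theta h <= k.-1 by lia.
    apply: Nleast; split; first by lia.
    move=> M; rewrite prednK; last lia.
    rewrite leq_eqVlt => /predU1P[<-|]; last by rewrite kN; apply: Nmax.
    by rewrite theta_const -?hk ?subn1 //; lia.
  exists (N + Nmin theta h).+1; split; first by lia.
  rewrite theta_const; last by lia.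
  by rewrite !ifF; lia.
- by move=> k ->.
- by rewrite ltnn eqxx.
- by move=> k kN; rewrite !ifF //; lia.
Qed.

Lemma W1_has_sum p : W1 theta p ->
  exists2 x, has_sum p.1 x & has_sum p.2 x.
Proof.
case: p => g h [/= gp hs lt eqN gt].
have [hmax _] := NminP h hs.
have [n eN] : exists n, Nmin theta h = n.+1.
  by exists (Nmin theta h).-1; rewrite prednK //; case: hmax.
rewrite eN in lt eqN gt hmax.
exists (INR (lead h n).+1 / INR b ^ n)%R; last exact: maximal_has_sum.
apply: (@has_sum_eventually _ _ _ 0) => M nM.
rewrite addn0 -(subnKC nM) addKn; elim: (M - n) => [|k IH].
  rewrite addn0 muln1; case: (n) lt eqN => [|m] lt /= ->; rewrite addn1 //.
  by rewrite addnS (@eq_lead g h) // => i im; rewrite lt.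
by rewrite addnS /= IH gt ?addn0 ?expnSr ?mulnA 1?mulnC ?mulnA //; lia.
Qed.

Lemma partner_primary h : secondary_aux theta h -> primary_aux theta (partner h).
Proof. by move=> /partner_W1[]. Qed.

Lemma partner_has_sum h x : secondary_aux theta h -> has_sum h x ->
  has_sum (partner h) x.
Proof.
move=> /partner_W1/W1_has_sum[y py hy] hx.
by rewrite (has_sum_unique h x y hx hy).
Qed.

Lemma partner0 h : secondary_aux theta h -> partner h 0 = h 0.
Proof. by move=> hs; rewrite /partner; have [[->]] := NminP h hs. Qed.

(* The two components of a pair in [W1] agree at 0, so replacing the first by
   [g] forces the value of the second at 0. *)
Lemma W1_eq_pos p g : W1 theta p -> (forall k, 0 < k -> p.1 k = g k) ->
  W1 theta (g, fun k => if k == 0 then g 0 else p.2 k).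
Proof.
case: p => f h /= [/= fp hs lt eqN gt] fg.
have eN : Nmin theta (fun k => if k == 0 then g 0 else h k) = Nmin theta h.
  by rewrite /Nmin (@eq_maximal_after _ h) //; case.
have [[N_gt0 _] _] := NminP h hs.
split; rewrite /= ?eN.
- case: fp => f1 f2; split=> [k k2|N N_gt0'].
    by rewrite -fg ?f1 //; lia.
  by have [M [NM hM]] := f2 N N_gt0'; exists M; rewrite -fg //; lia.
- case: hs => h1 [N h2]; split=> [[|k] // k2|]; first exact: h1.
  by exists N; rewrite (@eq_maximal_after _ h) //; case.
- by case=> //= k kN; rewrite -fg // lt.
- by rewrite -fg // eqN; case: (Nmin theta h) N_gt0.
- by move=> k kN; rewrite -fg ?gt //; lia.
Qed.

(** * Real numbers as sets of functions of equal value *)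

(** The common form of all elements of the base set, from [base_F] and [base_G2] alike. *)
Definition aux_class (h : nat -> nat) (x : Rdefinitions.R) :
    set (nat -> nat) :=
  [set g | reduced g /\ sigma g = sigma h /\ has_sum g x].

Lemma eq_sigma f g : f 0 = g 0 -> sigma f = sigma g.
Proof. by rewrite /sigma => ->. Qed.

(** A reduced function with sum [x] is primary, and then agrees with [p.1] on positive positions, or
    secondary, and then its partner does. *)
Lemma F_class p x : W1 theta p -> has_sum p.1 x ->
  [set f | exists q, [/\ W1 theta q, aux_equiv p.1 q.1 & f = q.1 \/ f = q.2]]
  = aux_class p.1 x.
Proof.
move=> Wp px; have [pp _ _ _ _] := Wp.
have fromW g : primary_aux theta g -> sigma g = sigma p.1 -> has_sum g x ->
    exists2 q, W1 theta q /\ aux_equiv p.1 q.1 & q.1 = g.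
  move=> gp sg gx; have e := primary_unique p.1 g x pp gp px gx.
  exists (g, fun k => if k == 0 then g 0 else p.2 k) => //.
  by split; [exact: W1_eq_pos | split].
apply/seteqP; split=> g /=.
  move=> [q [Wq [e se] gq]]; have qx := eq_has_sum p.1 q.1 x e px.
  have [y qy1 qy2] := W1_has_sum q Wq.
  have [qp qs qlt _ _] := Wq; rewrite (has_sum_unique _ _ _ qy1 qx) in qy2.
  case: gq => ->; first by split; [exact: primary_reduced | split].
  split; [exact: secondary_reduced | split=> //].
  rewrite se; apply: eq_sigma; rewrite qlt //.
  by have [[]] := NminP _ qs.
move=> [gr [sg gx]]; have [gp|gs] := reduced_auxVaux g gr.
  by have [q [Wq pq] qg] := fromW g gp sg gx; exists q; split=> //; left.
have sgp := eq_sigma _ _ (partner0 g gs).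
exists (partner g, g); split; [exact: partner_W1 | | by right].
split; last by rewrite sgp.
apply: primary_unique (partner_has_sum g x gs gx) => //.
exact: partner_primary.
Qed.

Lemma W1_fst_of_W2 h p : W2 theta h -> W1 theta p ->
  (forall k, 0 < k -> p.1 k = h k) -> False.
Proof.
move=> [_ noW] Wp e; apply: noW; have := W1_eq_pos p h Wp e.
by eexists; [eassumption | left].
Qed.

(** A secondary function with sum [x] would have a partner agreeing with [h] on positive positions,
    which would put [h] into a pair of [W1]. *)
Lemma G2_class h x : W2 theta h -> has_sum h x ->
  [set g | W2 theta g /\ aux_equiv h g] = aux_class h x.
Proof.
move=> Wh hx; have [hp _] := Wh; apply/seteqP; split=> g /=.
  move=> [[gp _] [e sg]]; split; first exact: primary_reduced.
  by split; [| exact: eq_has_sum hx].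
move=> [gr [sg gx]]; have [gp|gs] := reduced_auxVaux g gr; last first.
  case: (W1_fst_of_W2 h (partner g, g) Wh); first exact: partner_W1.
  apply: primary_unique (partner_has_sum g x gs gx) hx => //.
  exact: partner_primary.
have e := primary_unique g h x gp hp gx hx.
split; last by split=> // k k_gt0; rewrite e.
split=> // -[q Wq [gq|gq]].
  by apply: (W1_fst_of_W2 h q Wh Wq); rewrite -gq.
by apply: (primary_not_secondary g gp); rewrite gq; case: Wq.
Qed.

Lemma base_setP beta : base_set theta beta <->
  exists h x, [/\ reduced h, has_sum h x & beta = aux_class h x].
Proof.
split=> [[[p Wp ->]|[h Wh ->]]|[h [x [hr hx ->]]]].
- have [x px _] := W1_has_sum p Wp; have [pp _ _ _ _] := Wp.
  by exists p.1, x; rewrite (F_class p x) //; split=> //; apply: primary_reduced.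
- have hr := primary_reduced h Wh.1; have [x hx] := reduced_has_sum h hr.
  by exists h, x; rewrite (G2_class h x).
(* Passing to the partner keeps sign and sum. *)
wlog hp : h hr hx / primary_aux theta h.
  move=> primary_case; have [hp|hs] := reduced_auxVaux h hr.
    exact: primary_case.
  have hp := partner_primary h hs.
  have -> : aux_class h x = aux_class (partner h) x.
    by rewrite /aux_class (eq_sigma _ _ (partner0 h hs)).
  by apply: primary_case; [exact: primary_reduced|exact: partner_has_sum|].
have [[q Wq hq]|noW] := pselect (exists2 p, W1 theta p & h = p.1 \/ h = p.2).
  case: hq => hq; subst h; last first.
    by case: (primary_not_secondary _ hp); case: Wq.
  by left; exists q => //; rewrite (F_class q x).
by right; exists h; rewrite -?(G2_class h x).
Qed.

Lemma base_ofE h x : reduced h -> has_sum h x ->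
  base_of theta h = aux_class h x.
Proof.
move=> hr hx; apply: get_unique.
  by split; [apply/base_setP; exists h, x | split].
move=> beta [/base_setP[g [y [gr gy ->]]] [_ [sh hy]]].
by rewrite /aux_class sh (has_sum_unique h x y).
Qed.

(** Contractions fix position 0 and the sum. Conversely, a convergent [f] has bounded scaled partial
    sums and so reaches a reduced function of equal sign and sum. *)
Lemma r_aux_class h x :
  r_ theta (aux_class h x) = [set f | sigma f = sigma h /\ has_sum f x].
Proof.
apply/seteqP; split=> f /=.
  move=> [g [gr [sg gx]] fg]; split; last exact: reaches_has_sum gx.
  rewrite -sg; apply: eq_sigma; have [C [app eC]] := fg 1 isT.
  by rewrite -eC // seq_contraction0.
move=> [sf fx]; have [K fK] := has_sum_bounded f x fx.
have [g [g0 gr fg]] := bounded_reaches f K fK; exists g => //.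
by split=> //; split; [rewrite -sf; exact: eq_sigma | exact: has_sum_reaches fx].
Qed.

Definition sign (f : nat -> nat) : Rdefinitions.R :=
  if odd (f 0) then (-1)%R else 1%R.

(** Says that [sign f] times the sum of [f] is [y], with the sign, whose square is 1, moved to the
    side of [y]. *)
Definition has_value (f : nat -> nat) (y : Rdefinitions.R) : Prop :=
  has_sum f (sign f * y).

Definition real_with (y : Rdefinitions.R) : set (nat -> nat) :=
  [set f | has_value f y].

Lemma sign_sqr f : (sign f * sign f = 1)%R.
Proof. by rewrite /sign; case: ifP => _; lra. Qed.

Lemma has_valueP f x : has_sum f x <-> has_value f (sign f * x).
Proof. by rewrite /has_value -Rmult_assoc sign_sqr Rmult_1_l. Qed.

Lemma has_value_unique f y z : has_value f y -> has_value f z -> y = z.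
Proof.
move=> fy fz; have := has_sum_unique f _ _ fy fz.
by rewrite /sign; case: ifP => _; lra.
Qed.

Lemma eq_sign f g : sigma f = sigma g <-> sign f = sign g.
Proof.
rewrite /sigma /sign; case: (odd (f 0)); case: (odd (g 0)); split=> //; lra.
Qed.

Lemma has_sum_ge0 f x : has_sum f x -> (0 <= x)%R.
Proof.
move=> /(has_sum_lead _ _ 0); rewrite Rmult_1_r.
exact/Rle_trans/pos_INR.
Qed.

Lemma has_sum0 f : (forall k, 0 < k -> f k = 0) -> has_sum f 0.
Proof.
move=> f0; have -> : 0%R = (INR 0 / INR b ^ 0)%R by rewrite /=; field.
apply: (@has_sum_eventually _ _ _ 0) => M _; rewrite mul0n addn0.
by elim: M => [|M /= ->]; rewrite /= f0 // muln0.
Qed.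

(** The two classes joined in [real0] carry the two signs of the sum 0, and both give the value
    0. *)
Lemma real0E : real0 theta = real_with 0.
Proof.
rewrite /real0 /beta1 /beta2.
have r0 f : (forall k, 0 < k -> f k = 0) -> r_ theta (base_of theta f) =
    [set g | sigma g = sigma f /\ has_sum g 0].
  move=> f0; rewrite (base_ofE f 0) ?r_aux_class //; last exact: has_sum0.
  by move=> k k2; rewrite f0 //; lia.
rewrite !r0 //; last by case.
rewrite /real_with /has_value; apply/seteqP; split=> f /=; rewrite Rmult_0_r.
  by case=> [[]|[]].
by move=> fx; rewrite /sigma /=; case: ifP; [right | left].
Qed.

(** Sums are nonnegative, so a nonzero value determines the sign. *)
Lemma r_aux_class_value h x : has_sum h x -> x <> 0%R ->
  r_ theta (aux_class h x) = real_with (sign h * x).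
Proof.
move=> hx x_neq0; have x_ge0 := has_sum_ge0 h x hx.
rewrite r_aux_class /real_with; apply/seteqP; split=> f /=.
  by case=> /eq_sign sf fx; rewrite -sf; exact: (has_valueP f x).1.
rewrite eq_sign /has_value => fy; have := has_sum_ge0 _ _ fy; move: fy.
have e : (-1 * (-1 * x) = x)%R by lra.
rewrite /sign; case: ifP => _; case: ifP => _;
  rewrite ?e ?Rmult_1_l => fy y_ge0; split=> //; lra.
Qed.

Lemma realsP a :
  reals theta a <-> exists f y, has_value f y /\ a = real_with y.
Proof.
split=> [[->|[beta [/base_setP[h [x [hr hx ->]]] n1 n2 ->]]]|[f [y [fy ->]]]].
- exists (fun=> 0), 0%R; split; last exact: real0E.
  by rewrite /has_value Rmult_0_r; apply: has_sum0.
- exists h, (sign h * x)%R; split; first exact: (has_valueP h x).1.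
  apply: r_aux_class_value => // x0; subst x.
  (* A class of sum 0 is one of the two excluded ones, according to its sign. *)
  have : sigma h = 1 \/ sigma h = 0 by rewrite /sigma; case: ifP; auto.
  case=> sh; [apply: n1 | apply: n2]; rewrite /beta1 /beta2.
    rewrite (base_ofE _ 0); [by rewrite /aux_class sh | by case=> [|[]]|].
    exact: has_sum0.
  rewrite (base_ofE _ 0); [by rewrite /aux_class sh | by case=> [|[]]|].
  by apply: has_sum0; case.
have [->|y_neq0] := pselect (y = 0%R); first by left; rewrite real0E.
have [K fK] := has_sum_bounded f _ fy.
have [h [h0 hr fh]] := bounded_reaches f K fK.
have sh : sign h = sign f by rewrite /sign h0.
have hy : has_value h y.
  by rewrite /has_value sh; apply: has_sum_reaches fy.
have x_neq0 : (sign h * y)%R <> 0%R.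
  by rewrite /sign; case: ifP => _; lra.
right; exists (aux_class h (sign h * y)); split.
- by apply/base_setP; exists h, (sign h * y)%R.
- rewrite /beta1 (base_ofE (fun=> 0) 0); [|by case=> [|[]]|exact: has_sum0].
  move=> /seteqP[/(_ h) sub _]; have [|_ [_ h0x]] := sub; first by split.
  exact: x_neq0 (has_sum_unique h _ _ hy h0x).
- rewrite /beta2 (base_ofE _ 0); [|by case=> [|[]]|by apply: has_sum0; case].
  move=> /seteqP[/(_ h) sub _]; have [|_ [_ h0x]] := sub; first by split.
  exact: x_neq0 (has_sum_unique h _ _ hy h0x).
by rewrite r_aux_class_value // -Rmult_assoc sign_sqr Rmult_1_l.
Qed.

Lemma real_with_inj f y z : has_value f y -> real_with y = real_with z -> y = z.
Proof.
move=> fy /seteqP[/(_ f fy) fz _]; exact: has_value_unique fy fz.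
Qed.

Lemma real_ofE f y : has_value f y -> real_of theta f = real_with y.
Proof.
move=> fy; apply: get_unique; first by split=> //; apply/realsP; exists f, y.
by move=> a [/realsP[g [z [_ ->]]] fz]; rewrite (has_value_unique f z y).
Qed.

(** * Multiplication *)

Lemma prod_theta n : \prod_(1 <= j < n.+1) theta j = b ^ n.
Proof.
elim: n => [|n IH]; first by rewrite big_geq.
by rewrite big_nat_recr //= IH theta_const // expnSr.
Qed.

Lemma R_const n k K :
  R theta n.+1 k.+1 K.+1 = if n + k <= K then b ^ (K - (n + k)) else 0.
Proof.
rewrite /R /greatest !prod_theta.
have bE t : (t * b ^ n * b ^ k <= b ^ K) =
    (t <= if n + k <= K then b ^ (K - (n + k)) else 0).
  rewrite -mulnA -expnD; have [le_K|lt_K] := leqP (n + k) K.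
    have -> : b ^ K = b ^ (K - (n + k)) * b ^ (n + k) by rewrite -expnD subnK.
    by rewrite leq_pmul2r // expn_gt0 b_gt0.
  rewrite leqn0; case: t => [|t]; first by rewrite mul0n.
  apply/negbTE; rewrite -ltnNge; apply: (@leq_trans (b ^ (n + k))).
    by rewrite ltn_exp2l.
  by rewrite leq_pmull.
apply: get_unique => [|t [/= ]]; first by split=> [/=|t /=]; rewrite bE.
rewrite bE => le_t /(_ (if n + k <= K then b ^ (K - (n + k)) else 0)).
by rewrite /= bE leqnn => /(_ isT) ge_t; apply/eqP; rewrite eqn_leq le_t.
Qed.

(** Past [M = n + k] each value of [R] is [b] times the previous one and [Upsilon] cancels them;
    before it all values vanish. At [M = n + k] the value is 1, with 0 or nothing before it. *)
Lemma rest_const n k M : rest theta n.+1 k.+1 M.+1 = (M == n + k).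
Proof.
rewrite /rest eqSS; case: M => [|M]; rewrite !R_const /=.
  by case: (n + k) => [|m]; rewrite ?subnn.
rewrite theta_const // /Upsilon.
have [leM|ltM|<-] := ltngtP M.+1 (n + k).
- by rewrite ifF ?muln0 //; lia.
- by move: ltM; rewrite ltnS => leM; rewrite leM subSn // expnS maxnn minnn subnn.
- by rewrite ltnn muln0 subnn.
Qed.

Lemma subproduct_const f g M :
  subproduct theta f g M.+1 = \sum_(i < M.+1) f i.+1 * g (M - i).+1.
Proof.
rewrite /subproduct /= big_add1 big_mkord; apply: eq_bigr => i _.
have iM : i <= M by rewrite -ltnS.
rewrite big_add1 big_mkord (bigD1 (Ordinal (leq_subr i M : M - i < M.+1))) //=.
rewrite rest_const subnKC // eqxx muln1 big1 ?addn0 // => j.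
rewrite -val_eqE /= rest_const => ne_j.
suff -> : (M == i + j) = false by rewrite muln0.
by apply: contraNF ne_j => /eqP eM; rewrite [X in X - i]eM addKn.
Qed.

Lemma INR_sum n (F : nat -> nat) :
  INR (\sum_(i < n.+1) F i) = sum_f_R0 (fun i => INR (F i)) n.
Proof.
elim: n => [|n IH]; first by rewrite big_ord1.
by rewrite big_ord_recr plus_INR IH.
Qed.

Lemma ex_series_Rabs_term f x :
  has_sum f x -> ex_series (fun n => Rabs (term f n)).
Proof.
by exists x; apply: is_series_ext H => n; rewrite Rabs_pos_eq //; apply: term_ge0.
Qed.

(* The subproduct is the Cauchy product of the two series. *)
Lemma has_sum_subproduct f g x y : has_sum f x -> has_sum g y ->
  has_sum (subproduct theta f g) (x * y).
Proof.
move=> fx gy.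
have := is_series_mult _ _ _ _ fx gy (ex_series_Rabs_term f x fx)
  (ex_series_Rabs_term g y gy).
apply: is_series_ext => n; rewrite {3}/term subproduct_const.
rewrite (INR_sum n (fun i => f i.+1 * g (n - i).+1)).
rewrite /Rdiv Rmult_comm scal_sum; apply: PartSum.sum_eq => i /leP i_n.
have -> : (INR b ^ n = INR b ^ i * INR b ^ (n - i))%R.
  by rewrite -pow_add; congr (_ ^ _)%R; lia.
rewrite /term minusE mult_INR.
by field; split; apply: Rgt_not_eq; apply: Rb_pow_gt0.
Qed.

Lemma has_value_subproduct f g y z : has_value f y -> has_value g z ->
  has_value (subproduct theta f g) (y * z).
Proof.
move=> fy gz; rewrite /has_value.
(* At position 0 the subproduct adds, so parities add and signs multiply. *)
have -> : (sign (subproduct theta f g) * (y * z) =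
           (sign f * y) * (sign g * z))%R.
  rewrite /sign /subproduct /= oddD.
  by case: (odd (f 0)); case: (odd (g 0)) => /=; lra.
exact: has_sum_subproduct.
Qed.

(** The hypotheses make both sets nonempty, so [get] returns functions of values [y] and [z],
    whichever they are. *)
Lemma real_mulE f g y z : has_value f y -> has_value g z ->
  real_mul theta (real_with y) (real_with z) = real_with (y * z).
Proof.
move=> fy gz; apply/real_ofE/has_value_subproduct.
- by apply: (getPex (P := real_with y)); exists f.
- by apply: (getPex (P := real_with z)); exists g.
Qed.

(** Represents [m / b^n], with the sign given by the parity of [s]. *)
Definition single_digit (s n m : nat) : nat -> nat :=
  fun k => if k == 0 then s else if k == n.+1 then m else 0.

Lemma single_digit_sum s n m :
  has_sum (single_digit s n m) (INR m / INR b ^ n).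
Proof.
apply: (@has_sum_eventually _ _ _ 0) => M nM.
have low i : i < n -> lead (single_digit s n m) i = 0.
  elim: i => [|i IH] i_n /=; rewrite /single_digit /= ifF //; try lia.
  by rewrite -/(single_digit s n m) IH ?muln0 //; lia.
rewrite addn0 -(subnKC nM) addKn; elim: (M - n) => [|k IH].
  rewrite addn0 muln1; case: (n) low => [|i] low /=.
    by rewrite /single_digit.
  by rewrite low // muln0 /single_digit /= eqxx.
rewrite addnS /= IH {1}/single_digit /= ifF; last lia.
by rewrite addn0 mulnCA -expnS.
Qed.

Lemma nat_primary_value m : has_value (nat_primary m) (INR m).
Proof.
rewrite /has_value /sign /= Rmult_1_l.
have := single_digit_sum 0 0 m; rewrite /Rdiv Rinv_1 Rmult_1_r.
by apply: eq_has_sum; case.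
Qed.

Lemma real_natE m : real_nat theta m = real_with (INR m).
Proof. exact/real_ofE/nat_primary_value. Qed.

Lemma INR_pow_value N : has_value (nat_primary (b ^ N)) (INR b ^ N).
Proof. by rewrite -INR_expn; apply: nat_primary_value. Qed.

Lemma inv_pow_value N : has_value (single_digit 0 N 1) (/ INR b ^ N).
Proof.
rewrite /has_value /sign /= Rmult_1_l -[X in has_sum _ X]Rmult_1_l.
exact: single_digit_sum.
Qed.

Lemma real_expE N :
  real_exp theta (real_nat theta b) N = real_with (INR b ^ N).
Proof.
case: N => [|N]; first by rewrite /real_exp /= /real1 real_natE.
rewrite real_natE; elim: N => [|N IH]; first by rewrite /real_exp /= Rmult_1_r.
transitivity (real_mul theta (real_with (INR b))
                (real_exp theta (real_with (INR b)) N.+1)); first by [].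
rewrite IH (real_mulE (nat_primary b) (nat_primary (b ^ N.+1))) //.
  exact: nat_primary_value.
exact: INR_pow_value.
Qed.

Lemma real_invE f g y : y <> 0%R -> has_value f y -> has_value g (/ y) ->
  real_inv theta (real_with y) = real_with (/ y).
Proof.
move=> y_neq0 fy gy; have one : real1 theta = real_with 1 by apply: real_natE.
apply: get_unique.
  split; first by apply/realsP; exists g, (/ y)%R.
  by rewrite (real_mulE f g) // Rinv_r.
move=> d [/realsP[k [z [kz ->]]]]; rewrite (real_mulE f k) // one => e.
have yz : (y * z = 1)%R.
  exact: real_with_inj (has_value_subproduct f k y z fy kz) e.
by congr real_with; rewrite -[LHS]Rmult_1_l -(Rinv_l y) // Rmult_assoc yz Rmult_1_r.
Qed.

Lemma real_inv_exp N :
  real_inv theta (real_exp theta (real_nat theta b) N) =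
  real_with (/ INR b ^ N).
Proof.
rewrite real_expE; apply: (real_invE (nat_primary (b ^ N)) (single_digit 0 N 1)).
- exact: Rgt_not_eq (Rb_pow_gt0 N).
- exact: INR_pow_value.
- exact: inv_pow_value.
Qed.

Lemma real_mul_inv_exp f m N : has_sum f (INR m) ->
  real_mul theta (real_with (sign f * INR m))
    (real_inv theta (real_exp theta (real_nat theta b) N)) =
  real_with (sign f * (INR m / INR b ^ N)).
Proof.
move=> fm; rewrite real_inv_exp (real_mulE f (single_digit 0 N 1)).
- by congr real_with; rewrite Rmult_assoc.
- exact: (has_valueP f (INR m)).1.
- exact: inv_pow_value.
Qed.

(** * Integers and terminating quotients *)

(** Put [m] as one oversized digit at position [n.+1], append maximal digits and carry to the left.
    The tail is untouched and supplies the unit that turns [m] into [m.+1]. *)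
Lemma exists_secondary s m n : exists h,
  [/\ secondary_aux theta h, maximal_after theta h n.+1, h 0 = s,
      has_sum h (INR m.+1 / INR b ^ n) & n = 0 -> h 1 = m].
Proof.
pose f k := if k == 0 then s else if k <= n then 0
            else if k == n.+1 then m else b - 1.
have [C [app eC tl hd]] := normalize n f; set h := seq_contraction _ _ _ in eC tl hd.
have hmax : maximal_after theta h n.+1.
  split=> // M nM; rewrite tl // theta_const; last lia.
  by rewrite /f !ifF //; lia.
have lead_f : lead f n = m.
  have low i : i < n -> lead f i = 0.
    elim: i => [|i IH] i_n /=; rewrite /f /= ?i_n //.
    by rewrite -/f IH ?muln0 // ltnW.
  have [n0|n_gt0] := posnP n; first by rewrite n0 /= /f n0.
  rewrite -{1}(prednK n_gt0) /= low ?ltn_predL // muln0 prednK // /f /=.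
  by rewrite ltnn eqxx.
have lead_h : lead h n = m by rewrite eC // subnn divn1.
exists h; split=> //.
- split; last by exists n.+1.
  move=> k k2; rewrite theta_const; last lia.
  have [kn|nk] := leqP k n.+1; first by apply: hd; rewrite k2.
  by rewrite hmax.2 // theta_const; lia.
- exact: seq_contraction0.
- by rewrite -lead_h; apply: maximal_has_sum.
- by move=> n0; move: lead_h; rewrite n0.
Qed.

Lemma single_digit_primary s m : primary_aux theta (single_digit s 0 m).
Proof.
split=> [[|[|k]] // _|N N_gt0]; first by rewrite theta_const.
exists N.+1; split=> //; rewrite theta_const //.
by rewrite /single_digit; case: N N_gt0 => //= N _; lia.
Qed.

Lemma is_integerP a : is_integer theta a <->
  exists f m, has_sum f (INR m) /\ a = real_with (sign f * INR m).
Proof.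
split.
  move=> [ar [->|[p [h [pp ap hs ah Psi1]]]]].
    exists (fun=> 0), 0; rewrite /= Rmult_0_r real0E; split=> //.
    exact: has_sum0.
  have [f [y [_ ea]]] := (realsP a).1 ar; rewrite {}ea in ap ah *.
  have [hmax _] := NminP h hs.
  have [n eN] : exists n, Nmin theta h = n.+1.
    by exists (Nmin theta h).-1; rewrite prednK //; case: hmax.
  rewrite eN in hmax; have hx := maximal_has_sum h n hmax.
  have x_gt0 : (0 < INR (lead h n).+1 / INR b ^ n)%R.
    by apply: Rdiv_lt_0_compat => //; apply: (lt_INR 0); apply/ltP.
  have shy := has_sum_unique h _ _ ah hx.
  (* Both functions have value [y], which is nonzero, so their signs agree. *)
  have sph : sign p = sign h.
    have := has_sum_ge0 p _ ap; move: x_gt0; rewrite -shy /sign.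
    by case: ifP => _; case: ifP => _; lra.
  have px : has_sum p (sign h * y) by rewrite -sph.
  (* [Psi p h] is a true minimum only if [p] and [h] differ at a positive position; otherwise [p]
     would be secondary as well. *)
  have p_neq_h : exists k, [set k | 0 < k /\ p k <> h k] k.
    apply: contrapT => no_k; apply: (primary_not_secondary p pp).
    case: hs => hr [N hN]; split; first by case: pp.
    exists N; rewrite (@eq_maximal_after p h) // => k k2; apply: contrapT => pk.
    by apply: no_k; exists k; split=> //; lia.
  have [[_]] := leastP _ p_neq_h; rewrite -/(Psi p h) Psi1 => p1 _.
  (* For [n > 0] the carry happens after position 1, so [p], which agrees with [partner h], would
     agree with [h] there, against [Psi p h = 1]. *)
  have n0 : n = 0.
    case: n eN {hmax hx x_gt0 shy} => // n eN; case: p1.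
    rewrite (primary_unique p (partner h) _ pp (partner_primary h hs) px) //.
      by rewrite /partner eN.
    exact: partner_has_sum.
  exists h, (h 1).+1; subst n; move: shy hx; rewrite /Rdiv Rinv_1 Rmult_1_r => shy.
  split=> //; congr real_with; rewrite -[in RHS]/(lead h 0) -shy.
  by rewrite -Rmult_assoc sign_sqr Rmult_1_l.
move=> [f [m [fm ->]]]; split.
  apply/realsP; exists f, (sign f * INR m)%R; split=> //.
  exact: (has_valueP f (INR m)).1.
case: m fm => [|m] fm; first by left; rewrite /= Rmult_0_r real0E.
(* The secondary representative has [m] at position 1 and the primary one has [m.+1], so they differ
   there. *)
right; have [h [hs _ h0 hm /(_ erefl) h1]] := exists_secondary (f 0) m 0.
have ep : sign (single_digit (f 0) 0 m.+1) = sign f by [].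
have eh : sign h = sign f by rewrite /sign h0.
exists (single_digit (f 0) 0 m.+1), h; split=> //.
- exact: single_digit_primary.
- rewrite -ep; apply: (has_valueP _ _).1.
  by have := single_digit_sum (f 0) 0 m.+1; rewrite /Rdiv Rinv_1 Rmult_1_r.
- rewrite -eh; apply: (has_valueP _ _).1.
  by move: hm; rewrite /Rdiv Rinv_1 Rmult_1_r.
pose P := [set n | 0 < n /\ single_digit (f 0) 0 m.+1 n <> h n].
have P1 : P 1 by split=> //; rewrite h1 /single_digit /=; lia.
have [[Psi_gt0 _] /(_ 1 P1)] := leastP P (ex_intro _ 1 P1).
rewrite /Psi -/P; move: Psi_gt0; lia.
Qed.

Lemma integer_pow N : is_integer theta (real_exp theta (real_nat theta b) N).
Proof.
rewrite real_expE; apply/is_integerP; exists (nat_primary (b ^ N)), (b ^ N).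
rewrite INR_expn /sign /= Rmult_1_l; split=> //.
by have := INR_pow_value N; rewrite /has_value /sign /= Rmult_1_l.
Qed.

Lemma quotient_secondary f m N : has_sum f (INR m) -> m <> 0 ->
  exists2 h, secondary_aux theta h & real_with (sign f * (INR m / INR b ^ N)) h.
Proof.
case: m => // m fm _; have [h [hs _ h0 hm _]] := exists_secondary (f 0) m N.
exists h => //; have -> : sign f = sign h by rewrite /sign h0.
exact: (has_valueP h _).1.
Qed.

(** The exponent is [Nmin theta h - 1]; the maximal tail raises the partial sum by one to the
    numerator. *)
Lemma secondary_quotient h y : secondary_aux theta h -> has_value h y ->
  exists f m N, has_sum f (INR m) /\ y = (sign f * (INR m / INR b ^ N))%R.
Proof.
move=> hs hy; have [hmax _] := NminP h hs.
have [n eN] : exists n, Nmin theta h = n.+1.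
  by exists (Nmin theta h).-1; rewrite prednK //; case: hmax.
rewrite eN in hmax; exists (single_digit (h 0) 0 (lead h n).+1), (lead h n).+1, n.
split.
  have := single_digit_sum (h 0) 0 (lead h n).+1.
  by rewrite {1}/Rdiv Rinv_1 Rmult_1_r.
apply: (has_value_unique h y _ hy); apply: (has_valueP h _).1.
exact: maximal_has_sum.
Qed.

End ConstantSystem.

Theorem theorem10p0p8 (b : nat) (theta : nat -> nat)
    (hb : 2 <= b) (htheta : system_function theta)
    (hconst : forall n, 0 < n -> theta n = b)
    (a : set (nat -> nat)) (ha : reals theta a) (ha0 : a <> real0 theta) :
  b_adically_terminating theta b a <->
  exists2 h : nat -> nat, secondary_aux theta h & a h.
Proof.
split=> [[_ [c [N [ci ea]]]]|[h hs ah]].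
  have [f [m [fm ec]]] := (is_integerP b theta hb hconst c).1 ci; subst c.
  move: ea; rewrite real_mul_inv_exp // => ea; rewrite ea.
  apply: quotient_secondary => // m0; apply: ha0.
  by rewrite ea m0 (real0E b) // /Rdiv Rmult_0_l Rmult_0_r.
have [g [y [gy ea]]] := (realsP b theta hb hconst a).1 ha.
rewrite {}ea in ah ha ha0 *.
have [f [m [N [fm ey]]]] := secondary_quotient b theta hb hconst h y hs ah.
have fi : is_integer theta (real_with b (sign f * INR m)).
  by apply/(is_integerP b) => //; exists f, m.
have pow_neq0 : real_exp theta (real_nat theta b) N <> real0 theta.
  rewrite real_expE // (real0E b) // => e.
  have := real_with_inj b _ _ _ (INR_pow_value b hb N) e.
  have : (0 < INR b ^ N)%R.
    by apply: pow_lt; apply: (lt_INR 0); apply/ltP; apply: ltnW.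
  lra.
have eq_y : real_with b y = real_mul theta (real_with b (sign f * INR m))
    (real_inv theta (real_exp theta (real_nat theta b) N)).
  by rewrite real_mul_inv_exp // ey.
(* One quotient yields both claims, since the power of [b] is itself a nonzero integer. *)
split; [split=> //|]; last by exists (real_with b (sign f * INR m)), N.
exists (real_with b (sign f * INR m)), (real_exp theta (real_nat theta b) N).
by split=> //; apply: integer_pow.
Qed.
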